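(* The universal enveloping 2-associative differential algebra of a $B_\infty$ algebra $A$ is naturally endowed with the structure of a cofree 2-associative differential bialgebra $$U(A)=(T^c(A),\partial,\bullet,\odot,\Delta,1_{\mathbb K}),$$ where the comultiplication $\Delta$ is given by deconcatenation of tensors, and there is a functor $U\colon B_\infty\text{-alg}\to d\mathcal{A}s^{1,1}\text{-bialg}$.
   Context: Conventions. Vector spaces are $\mathbb Z$-graded over a field $\mathbb K$; maps have degree $0$ unless stated otherwise; the Koszul sign rule is used: $(f\otimes g)(a\otimes b)=(-1)^{|g||a|}f(a)\otimes g(b)$ and the symmetry is $a\otimes b\mapsto(-1)^{|a||b|}b\otimes a$. Tensor coalgebra. $T^c(X)=\bigoplus_{k\ge0}X^{\otimes k}$ with deconcatenation $\Delta(x_1\cdots x_k)=\sum_{i=0}^k x_1\cdots x_i\otimes x_{i+1}\cdots x_k$, counit the projection to $X^{\otimes0}=\mathbb K$, and unit $1=1_{\mathbb K}$; $p_1\colon T^c(X)\to X$ is the projection. A unital coalgebra (a counital coassociative coalgebra with specified group-like element $1$) is cofree if it is isomorphic to some $T^c(X)$. $B_\infty$ algebra (in the shifted convention). A $B_\infty$ structure on $X$ is a pair $(\mu,d)$ where $\mu\colon T^c(X)\otimes T^c(X)\to T^c(X)$ is a coalgebra map of degree $0$ that is associative with unit $1$, and $d\colon T^c(X)\to T^c(X)$ is a coderivation ($\Delta d=(d\otimes\mathrm{id}+\mathrm{id}\otimes d)\Delta$) of degree $-1$ with $d(1)=0$, $d^2=0$ and $d\mu=\mu(d\otimes\mathrm{id}+\mathrm{id}\otimes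 d)$. Its structure maps are $m_n=p_1d|_{X^{\otimes n}}$ ($n\ge1$) and $m_{i,j}=p_1\mu|_{X^{\otimes i}\otimes X^{\otimes j}}$ ($i,j\ge1$). Homomorphisms are degree $0$ linear maps commuting with all structure maps. This gives the category $B_\infty\text{-alg}$. 2-associative differential algebra. This is a (unital associative) differential graded algebra $(V,\bullet,1,\partial)$, with $\partial$ of degree $-1$, together with a second associative operation $\odot$ with the same unit $1$ and no further compatibility. 2-associative differential bialgebra. This is a 2-associative differential algebra $(V,\partial,\bullet,\odot,1)$ with a comultiplication $\Delta$ (and counit $\varepsilon$) such that $(V,\partial,\bullet,\Delta,1)$ is a differential graded bialgebra (a bialgebra, with $\partial$ both a derivation of $\bullet$ and a coderivation of $\Delta$), and $(V,\odot,\Delta,1)$ is a unital infinitesimal bialgebra, i.e. $\Delta(x\odot y)=x_{(1)}\otimes (x_{(2)}\odot y)+(x\odot y_{(1)})\otimes y_{(2)}-x\otimes y$ in Sweedler notation. Homomorphisms are degree $0$ linear maps preserving all the structure; they form the category $d\mathcal{A}s^{1,1}\text{-bialg}$. It is called cofree if it is cofree as a unital coalgebra. Universal enveloping algebra. The universal enveloping 2-associative differential algebra $U(A)$ of a $B_\infty$ algebra $A$ with structure $(\mu,d)$ is (up to canonical isomorphism) the tensor coalgebra $T^c(A)$ with $\partial=d$, $\bullet=\mu$, $\odot$ concatenation of tensors and unit $1_{\mathbb K}$; on homomorphisms $U(f)=T^c(f)=\bigoplus_k f^{\otimes k}$. *)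

(* Defs.v *)
From HB Require Import structures.
From mathcomp Require Import all_boot all_order all_algebra.
From mathcomp Require Import generic_quotient.
From mathcomp Require Import boolp classical_sets functions cardinality fsbigop.
From mathcomp.multinomials Require Import freeg.

Set Implicit Arguments.
Unset Strict Implicit.
Unset Printing Implicit Defensive.

Import GRing.Theory.
Local Open Scope ring_scope.
Local Open Scope quotient_scope.

(* The K-vector space with generators S and relations R: the free space
   {freeg S / K} modulo the linear span of R. *)
Section Presented.
Variables (K : fieldType) (S : choiceType) (R : {freeg S / K} -> Prop).

Inductive lspan : {freeg S / K} -> Prop :=
| lspan0 : lspan 0
| lspan_cons a r x : R r -> lspan x -> lspan (a *: r + x).

Lemma lspanD x y : lspan x -> lspan y -> lspan (x + y).
Proof.
elim=> [|a r z Rr _ IH] Hy; first by rewrite add0r.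
by rewrite -addrA; apply: lspan_cons => //; apply: IH.
Qed.

Lemma lspanZ a x : lspan x -> lspan (a *: x).
Proof.
elim=> [|b r z Rr _ IH]; first by rewrite scaler0; exact: lspan0.
by rewrite scalerDr scalerA; apply: lspan_cons.
Qed.

Lemma lspan_rel r : R r -> lspan r.
Proof. by move=> Rr; rewrite -[r]scale1r -[_ *: _]addr0; apply: lspan_cons => //; exact: lspan0. Qed.

Definition pres_equiv (x y : {freeg S / K}) : bool := `[< lspan (x - y) >].

Lemma pres_equiv_class : equiv_class_of pres_equiv.
Proof.
split=> [x|x y|y x z].
- by apply/asboolP; rewrite subrr; exact: lspan0.
- by apply/asboolP/asboolP => /(lspanZ (-1)); rewrite scaleN1r opprB.
- move=> /asboolP Hxy /asboolP Hyz; apply/asboolP.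
  by rewrite -[x](subrK y) -addrA; apply: lspanD.
Qed.
Canonical pres_equiv_rel := EquivRelPack pres_equiv_class.
Canonical pres_equiv_encModRel := defaultEncModRel pres_equiv.

Definition presented := {eq_quot pres_equiv}.
HB.instance Definition _ := Choice.on presented.
HB.instance Definition _ : EqQuotient _ pres_equiv presented := EqQuotient.on presented.

Lemma presP x y : lspan (x - y) <-> \pi_presented x = \pi_presented y.
Proof.
split=> [H|/eqP]; first by apply/eqP; rewrite piE; apply/asboolP.
by rewrite piE => /asboolP.
Qed.

Definition pres_add := lift_op2 presented +%R.
Definition pres_opp := lift_op1 presented -%R.
Definition pres_scale (a : K) := lift_op1 presented ( *:%R a).

Lemma pi_presD : {morph \pi_presented : x y / x + y >-> pres_add x y}.
Proof.
move=> x y /=; unlock pres_add; apply/presP.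
by rewrite opprD addrACA; apply: lspanD; apply/presP; rewrite reprK.
Qed.
Lemma pi_presN : {morph \pi_presented : x / - x >-> pres_opp x}.
Proof.
move=> x /=; unlock pres_opp; apply/presP.
by rewrite -opprD -scaleN1r; apply: lspanZ; apply/presP; rewrite reprK.
Qed.
Lemma pi_presZ a : {morph \pi_presented : x / a *: x >-> pres_scale a x}.
Proof.
move=> x /=; unlock pres_scale; apply/presP.
by rewrite -scalerBr; apply: lspanZ; apply/presP; rewrite reprK.
Qed.

Fact pres_addA : associative pres_add.
Proof. by elim/quotW=> x; elim/quotW=> y; elim/quotW=> z; rewrite -!pi_presD addrA. Qed.
Fact pres_addC : commutative pres_add.
Proof. by elim/quotW=> x; elim/quotW=> y; rewrite -!pi_presD addrC. Qed.
Fact pres_add0 : left_id (\pi_presented 0) pres_add.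
Proof. by elim/quotW=> x; rewrite -!pi_presD add0r. Qed.
Fact pres_addN : left_inverse (\pi_presented 0) pres_opp pres_add.
Proof. by elim/quotW=> x; rewrite -pi_presN -pi_presD addNr. Qed.
HB.instance Definition _ :=
  GRing.isZmodule.Build presented pres_addA pres_addC pres_add0 pres_addN.

Fact pres_scaleA a b x : pres_scale a (pres_scale b x) = pres_scale (a * b) x.
Proof. by elim/quotW: x => x; rewrite -!pi_presZ scalerA. Qed.
Fact pres_scale1 : left_id 1 pres_scale.
Proof. by elim/quotW=> x; rewrite -!pi_presZ scale1r. Qed.
Fact pres_scaleDr : right_distributive pres_scale +%R.
Proof.
move=> a; elim/quotW=> x; elim/quotW=> y.
by rewrite -[_ + _]pi_presD -!pi_presZ scalerDr pi_presD.
Qed.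
Fact pres_scaleDl x : {morph pres_scale^~ x : a b / a + b}.
Proof. by move=> a b; elim/quotW: x => x; rewrite -!pi_presZ scalerDl pi_presD. Qed.
HB.instance Definition _ := GRing.Zmodule_isLmodule.Build K presented
  pres_scaleA pres_scale1 pres_scaleDr pres_scaleDl.

Definition pres_pi (x : {freeg S / K}) : presented := \pi_presented x.

Lemma pres_pi_linear : linear pres_pi.
Proof. by move=> a x y; rewrite /pres_pi pi_presD pi_presZ. Qed.
HB.instance Definition _ := GRing.isLinear.Build K {freeg S / K} presented *:%R
  pres_pi pres_pi_linear.

Lemma pres_pi_rel r : R r -> pres_pi r = 0.
Proof.
move=> Rr; rewrite -(linear0 pres_pi); apply/presP.
by rewrite subr0; exact: lspan_rel.
Qed.

Definition pgen (s : S) : presented := pres_pi << s >>.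

Lemma pres_ind (P : presented -> Prop) :
  P 0 -> (forall a x y, P x -> P y -> P (a *: x + y)) ->
  (forall s, P (pgen s)) -> forall x, P x.
Proof.
move=> P0 PD Pg; elim/quotW=> x; rewrite -(freeg_sumE x).
elim: (dom x) => [|s r IH]; first by rewrite big_nil.
rewrite big_cons.
set u := << _ *g s >>.
have -> : u = coeff s x *: << s >>.
  by apply/eqP/freeg_eqP => y; rewrite coeffZ !coeffU mul1r.
by rewrite -/(pres_pi _) linearP; apply: PD => //; exact: Pg.
Qed.

HB.instance Definition _ (W : lmodType K) (f : S -> W) :=
  GRing.isZmodMorphism.Build {freeg S / K} W (fglift f) (lift_is_additive f).

Lemma fglift_scalable (W : lmodType K) (f : S -> W) : scalable (fglift f).
Proof.
have hU c s : << c *g s >> = c *: << s >> :> {freeg S / K}.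
  by apply/eqP/freeg_eqP => y; rewrite coeffZ !coeffU mul1r.
move=> a x; rewrite -[x in LHS]freeg_sumE -[x in RHS]freeg_sumE scaler_sumr.
rewrite !raddf_sum; apply: eq_bigr => s _.
by rewrite [in LHS]hU scalerA -hU /= !liftU scalerA.
Qed.
HB.instance Definition _ (W : lmodType K) (f : S -> W) :=
  GRing.isScalable.Build K {freeg S / K} W *:%R (fglift f) (fglift_scalable f).

Section Lift.
Variables (W : lmodType K) (f : S -> W).

Definition pres_lift (Rf : forall r, R r -> fglift f r = 0) (x : presented) : W :=
  fglift f (repr x).

Hypothesis Rf : forall r, R r -> fglift f r = 0.

Lemma pres_liftE x : pres_lift Rf (\pi_presented x) = fglift f x.
Proof.
rewrite /pres_lift; apply/eqP; rewrite -subr_eq0 -linearB; apply/eqP.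
have: lspan (repr (\pi_presented x) - x) by apply/presP; rewrite reprK.
elim=> [|a r z Rr _ IH]; first by rewrite linear0.
by rewrite linearP IH addr0 /= Rf // scaler0.
Qed.

Lemma pres_lift_gen s : pres_lift Rf (pgen s) = f s.
Proof. by rewrite pres_liftE liftU scale1r. Qed.

Lemma pres_lift_linear : linear (pres_lift Rf).
Proof.
move=> a; elim/quotW=> x; elim/quotW=> y.
by rewrite -!/(pres_pi _) -linearP !pres_liftE linearP.
Qed.
HB.instance Definition _ :=
  GRing.isLinear.Build K presented W *:%R (pres_lift Rf) pres_lift_linear.
End Lift.
End Presented.

Section Tensor.
Variable K : fieldType.

Section Def.
Variables V W : lmodType K.

(* The tensor product of V and W: the free space on V * W modulo bilinearity. *)
Inductive tens_rel : {freeg (V * W)%type / K} -> Prop :=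
| tens_rell a v v' w :
    tens_rel (<< (a *: v + v', w) >> - a *: << (v, w) >> - << (v', w) >>)
| tens_relr a v w w' :
    tens_rel (<< (v, a *: w + w') >> - a *: << (v, w) >> - << (v, w') >>).

Definition tensor := presented tens_rel.
HB.instance Definition _ := GRing.Lmodule.on tensor.

Definition tens (v : V) (w : W) : tensor := pgen tens_rel (v, w).
End Def.

Local Notation "v \ox w" := (tens v w) (at level 40, left associativity).

Section Bilinear.
Variables V W U : lmodType K.

Definition bilin (f : V -> W -> U) : Prop :=
  (forall w, linear (f^~ w)) /\ (forall v, linear (f v)).

Lemma bilin_tens_rel (f : V -> W -> U) : bilin f ->
  forall r, tens_rel r -> fglift (fun p => f p.1 p.2) r = 0.
Proof.
move=> [fl fr] r.
by case=> [a v v' w|a v w w']; rewrite !linearB linearZ /= !liftU !scale1r /=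
   ?fl ?fr addrAC addrK subrr.
Qed.

Definition tens_lift (f : V -> W -> U) (Hf : bilin f) : tensor V W -> U :=
  pres_lift (bilin_tens_rel Hf).
HB.instance Definition _ f Hf := GRing.Linear.on (@tens_lift f Hf).

Lemma tens_liftE f Hf v w : @tens_lift f Hf (v \ox w) = f v w.
Proof. exact: pres_lift_gen. Qed.
End Bilinear.

Lemma tens_bilin (V W : lmodType K) : bilin (@tens V W).
Proof.
split=> [w a v v'|v a w w'].
  by have /pres_pi_rel/eqP := tens_rell a v v' w;
     rewrite !linearB linearZ /= subr_eq0 subr_eq addrC => /eqP.
by have /pres_pi_rel/eqP := tens_relr a v w w';
   rewrite !linearB linearZ /= subr_eq0 subr_eq addrC => /eqP.
Qed.

Lemma tens_ind (V W : lmodType K) (P : tensor V W -> Prop) :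
  P 0 -> (forall a x y, P x -> P y -> P (a *: x + y)) ->
  (forall v w, P (v \ox w)) -> forall x, P x.
Proof. by move=> P0 PD Pg; apply: pres_ind => // -[v w]; exact: Pg. Qed.
End Tensor.

Notation "v \ox w" := (tens v w) (at level 40, left associativity).

Section TensorMaps.
Variable K : fieldType.

Section Map.
Variables V V' W W' : lmodType K.
Variables (f : {linear V -> V'}) (g : {linear W -> W'}).

Fact tmap_bilin : bilin (fun v w => f v \ox g w).
Proof.
have [tl tr] := tens_bilin V' W'.
by split=> [w a v v'|v a w w']; rewrite linearP ?tl ?tr.
Qed.
Definition tmap : tensor V W -> tensor V' W' := tens_lift tmap_bilin.
HB.instance Definition _ := GRing.Linear.on tmap.
Lemma tmapE v w : tmap (v \ox w) = f v \ox g w.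
Proof. exact: tens_liftE. Qed.
End Map.

Section Assoc.
Variables U V W : lmodType K.

Fact tassoc1_bilin (w : W) : bilin (fun (u : U) (v : V) => u \ox (v \ox w)).
Proof.
have [tl tr] := tens_bilin U (tensor V W); have [tl' tr'] := tens_bilin V W.
by split=> [v a x y|u a x y]; rewrite ?tl ?tl' ?tr.
Qed.
Fact tassoc_bilin : bilin (fun (t : tensor U V) (w : W) => tens_lift (tassoc1_bilin w) t).
Proof.
have [tl tr] := tens_bilin U (tensor V W); have [tl' tr'] := tens_bilin V W.
split=> [w a x y|t a w w']; first by rewrite linearP.
elim/tens_ind: t => [|b x y Hx Hy|u v]; first by rewrite !linear0 addr0.
  rewrite !linearP /= Hx Hy. by rewrite scalerDr addrACA.
by rewrite !tens_liftE tr' tr.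
Qed.
Definition tassoc : tensor (tensor U V) W -> tensor U (tensor V W) :=
  tens_lift tassoc_bilin.
HB.instance Definition _ := GRing.Linear.on tassoc.
Lemma tassocE u v w : tassoc (u \ox v \ox w) = u \ox (v \ox w).
Proof. by rewrite /tassoc !tens_liftE. Qed.

Fact tassocV1_bilin (u : U) : bilin (fun (v : V) (w : W) => u \ox v \ox w).
Proof.
have [tl tr] := tens_bilin (tensor U V) W; have [tl' tr'] := tens_bilin U V.
by split=> [w a x y|v a x y]; rewrite ?tr' ?tl ?tr.
Qed.
Fact tassocV_bilin : bilin (fun (u : U) (t : tensor V W) => tens_lift (tassocV1_bilin u) t).
Proof.
have [tl tr] := tens_bilin (tensor U V) W; have [tl' tr'] := tens_bilin U V.
split=> [t a u u'|u a x y]; last by rewrite linearP.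
elim/tens_ind: t => [|b x y Hx Hy|v w]; first by rewrite !linear0 addr0.
  rewrite !linearP /= Hx Hy. by rewrite scalerDr addrACA.
by rewrite !tens_liftE tl' tl.
Qed.
Definition tassocV : tensor U (tensor V W) -> tensor (tensor U V) W :=
  tens_lift tassocV_bilin.
HB.instance Definition _ := GRing.Linear.on tassocV.
Lemma tassocVE u v w : tassocV (u \ox (v \ox w)) = u \ox v \ox w.
Proof. by rewrite /tassocV !tens_liftE. Qed.
End Assoc.
End TensorMaps.

Section TensorCoalgebra.
Variable K : fieldType.

Section Words.
Variable X : lmodType K.

(* T^c(X), as the free space on words over X modulo linearity in each letter.
   The relations preserve the length of words, and the words of length k span
   the summand X^(x)k; the empty word spans X^(x)0 = K. *)
Inductive word_rel : {freeg (seq X) / K} -> Prop :=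
| word_reli u v a x y :
    word_rel (<< u ++ (a *: x + y) :: v >> - a *: << u ++ x :: v >>
              - << u ++ y :: v >>).

Definition tcoalg := presented word_rel.
HB.instance Definition _ := GRing.Lmodule.on tcoalg.

Definition tword (w : seq X) : tcoalg := pgen word_rel w.

Definition multilin (W : lmodType K) (f : seq X -> W) : Prop :=
  forall u v a x y,
    f (u ++ (a *: x + y) :: v) = a *: f (u ++ x :: v) + f (u ++ y :: v).

Lemma tword_multilin : multilin tword.
Proof.
move=> u v a x y; have := pres_pi_rel (word_reli u v a x y).
rewrite !linearB linearZ /= -addrA -opprD => /(canRL (subrK _)).
by rewrite add0r.
Qed.

Lemma tword_ind (P : tcoalg -> Prop) :
  P 0 -> (forall a x y, P x -> P y -> P (a *: x + y)) ->
  (forall w, P (tword w)) -> forall x, P x.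
Proof. exact: pres_ind. Qed.

Section Lift.
Variables (W : lmodType K) (f : seq X -> W).

Lemma multilin_word_rel : multilin f -> forall r, word_rel r -> fglift f r = 0.
Proof.
move=> Hf r; case=> u v a x y.
by rewrite !linearB linearZ /= !liftU !scale1r Hf addrAC addrK subrr.
Qed.

Hypothesis Hf : multilin f.
Definition tword_lift : tcoalg -> W := pres_lift (multilin_word_rel Hf).
HB.instance Definition _ := GRing.Linear.on tword_lift.
Lemma tword_liftE w : tword_lift (tword w) = f w.
Proof. exact: pres_lift_gen. Qed.
End Lift.

Definition tone : tcoalg := tword [::].

Fact counit_multilin : multilin (fun w : seq X => (nilp w)%:R : K^o).
Proof. by move=> [|z u] v a x y /=; rewrite scaler0 addr0. Qed.
Definition tcounit : tcoalg -> K^o := tword_lift counit_multilin.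
HB.instance Definition _ := GRing.Linear.on tcounit.

Fact tproj1_multilin : multilin (fun w : seq X => if w is [:: x] then x else 0).
Proof. by move=> [|z [|z' u]] [|t v] a x y //=; rewrite scaler0 addr0. Qed.
Definition tproj1 : tcoalg -> X := tword_lift tproj1_multilin.
HB.instance Definition _ := GRing.Linear.on tproj1.

Fact deconc_multilin :
  multilin (fun w : seq X => \sum_(i < (size w).+1) tword (take i w) \ox tword (drop i w)).
Proof.
have [tl tr] := tens_bilin tcoalg tcoalg.
move=> u v a x y; rewrite !size_cat /= scaler_sumr -big_split /=.
apply: eq_bigr => i _; rewrite !take_cat !drop_cat.
case: ltnP => _; first by rewrite tword_multilin tr.
case: (_ - _)%N => [|k] /=; last by rewrite tword_multilin tl.
by rewrite (tword_multilin [::]) tr.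
Qed.
Definition deconc : tcoalg -> tensor tcoalg tcoalg := tword_lift deconc_multilin.
HB.instance Definition _ := GRing.Linear.on deconc.

Fact lcat_multilin u : multilin (fun v => tword (u ++ v)).
Proof. by move=> v w a x y; rewrite !catA tword_multilin. Qed.
Definition lcat u : tcoalg -> tcoalg := tword_lift (lcat_multilin u).
HB.instance Definition _ u := GRing.Linear.on (lcat u).

Fact conc1_multilin t : multilin (fun w => lcat w t).
Proof.
move=> u v a x y.
elim/tword_ind: t => [|b s t Hs Ht|w]; first by rewrite !linear0 addr0.
  rewrite !linearP /= Hs Ht. by rewrite scalerDr addrACA.
by rewrite /lcat !tword_liftE -!catA !cat_cons tword_multilin.
Qed.
Fact conc_bilin : bilin (fun s t : tcoalg => tword_lift (conc1_multilin t) s).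
Proof.
split=> [t a s s'|s a t t']; first by rewrite linearP.
elim/tword_ind: s => [|b r s Hr Hs|w]; first by rewrite !linear0 addr0.
  rewrite !linearP /= Hr Hs. by rewrite scalerDr addrACA.
by rewrite !tword_liftE linearP.
Qed.
Definition conc : tensor tcoalg tcoalg -> tcoalg := tens_lift conc_bilin.
HB.instance Definition _ := GRing.Linear.on conc.
Lemma concE u v : conc (tword u \ox tword v) = tword (u ++ v).
Proof. by rewrite /conc tens_liftE tword_liftE /lcat tword_liftE. Qed.
End Words.

(* T^c(f) *)
Section WordMap.
Variables (X Y : lmodType K) (f : {linear X -> Y}).
Fact wmap_multilin : multilin (fun w => tword (map f w)).
Proof. by move=> u v a x y; rewrite !map_cat /= linearP tword_multilin. Qed.
Definition wmap : tcoalg X -> tcoalg Y := tword_lift wmap_multilin.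
HB.instance Definition _ := GRing.Linear.on wmap.
Lemma wmapE w : wmap (tword w) = tword (map f w).
Proof. exact: tword_liftE. Qed.
End WordMap.
End TensorCoalgebra.

Arguments tone {K X}.
Arguments tcounit {K X}.
Arguments tproj1 {K X}.
Arguments deconc {K X}.
Arguments conc {K X}.

Lemma lin0 (K : fieldType) (V W : lmodType K) (f : V -> W) : linear f -> f 0 = 0.
Proof. by move=> lf; rewrite -(subrr (0 : V)) -scaleN1r addrC lf scaleN1r addNr. Qed.

(* A grading is given by the projections onto the homogeneous components of the
   internal direct sum V = \bigoplus_n V_n, where V_n = {v | gproj n v = v}. *)
HB.mixin Record isGraded (K : fieldType) V of GRing.Lmodule K V := {
  gproj : int -> V -> V;
  gproj_linear : forall n, linear (gproj n);
  gproj_proj : forall m n v, gproj m (gproj n v) = if m == n then gproj n v else 0;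
  gproj_sum : forall v, exists2 s : seq int, uniq s & v = \sum_(n <- s) gproj n v
}.

#[short(type="gradedType")]
HB.structure Definition Graded (K : fieldType) :=
  {V of isGraded K V & GRing.Lmodule K V}.

Section GradedTheory.
Variable K : fieldType.
HB.instance Definition _ (V : gradedType K) n :=
  GRing.isLinear.Build K V V *:%R (@gproj K V n) (gproj_linear n).

Definition homog (V : gradedType K) (n : int) (v : V) : Prop := gproj n v = v.

Definition of_degree (V W : gradedType K) (e : int) (f : V -> W) : Prop :=
  forall n v, homog n v -> homog (n + e) (f v).

(* The map V -> U with restriction F n to V_n, for F n linear; the sum ranges
   over the finitely many n such that gproj n v <> 0. *)
Definition gsum (V : gradedType K) (U : lmodType K) (F : int -> V -> U) (v : V) : U :=
  \sum_(n \in [set: int]) F n (gproj n v).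

Section Gsum.
Variables (V : gradedType K) (U : lmodType K).
Implicit Types (F G : int -> V -> U).

Lemma gproj_out (v : V) : exists2 s : seq int, uniq s &
  forall n, n \notin s -> gproj n v = 0.
Proof.
have [s us Ev] := gproj_sum v; exists s => // n ns.
rewrite Ev linear_sum big_seq big1 //= => i si; rewrite gproj_proj.
by case: eqP => // E; rewrite E si in ns.
Qed.

Lemma gsumE F (s : seq int) v : (forall n, linear (F n)) -> uniq s ->
  (forall n, n \notin s -> gproj n v = 0) ->
  gsum F v = \sum_(n <- s) F n (gproj n v).
Proof.
move=> lF us Hs; rewrite /gsum (fsbigE s) //.
  by apply: eq_bigl => n; rewrite in_setT.
by move=> n _ ns; rewrite Hs // lin0.
Qed.

Lemma gsum_supp (v w : V) : exists s : seq int, [/\ uniq s,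
  forall n, n \notin s -> gproj n v = 0 & forall n, n \notin s -> gproj n w = 0].
Proof.
have [s us Hs] := gproj_out v; have [t ut Ht] := gproj_out w.
exists (undup (s ++ t)); split; first exact: undup_uniq.
  by move=> n; rewrite mem_undup mem_cat negb_or => /andP[/Hs].
by move=> n; rewrite mem_undup mem_cat negb_or => /andP[_ /Ht].
Qed.

Lemma gsum_linear F : (forall n, linear (F n)) -> linear (gsum F).
Proof.
move=> lF a v w; have [s [us Hv Hw]] := gsum_supp v w.
rewrite !(gsumE lF us) //; last by move=> n ns; rewrite linearP /= Hv // Hw // scaler0 addr0.
rewrite scaler_sumr -big_split; apply: eq_bigr => n _.
by rewrite linearP lF.
Qed.

Lemma gsum_comb F G H a v : (forall n, linear (F n)) -> (forall n, linear (G n)) ->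
  (forall n x, H n x = a *: F n x + G n x) -> gsum H v = a *: gsum F v + gsum G v.
Proof.
move=> lF lG EH; have [s us Hs] := gproj_out v.
have lH n : linear (H n).
  move=> b x y; rewrite !EH lF lG !scalerDr !scalerA [a * b]mulrC addrACA.
  by rewrite !addrA.
rewrite (gsumE lF us) // (gsumE lG us) // (gsumE lH us) //.
by rewrite scaler_sumr -big_split; apply: eq_bigr => n _; rewrite EH.
Qed.

Lemma gsum_homog F n v : (forall n, linear (F n)) -> homog n v -> gsum F v = F n v.
Proof.
move=> lF hv; rewrite (gsumE (s := [:: n]) lF) ?big_seq1 ?hv //.
by move=> m; rewrite inE => nm; rewrite -hv gproj_proj (negbTE nm).
Qed.

Lemma graded_ind (P : V -> Prop) : P 0 ->
  (forall a x y, P x -> P y -> P (a *: x + y)) ->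
  (forall n v, homog n v -> P v) -> forall v, P v.
Proof.
move=> P0 PD Ph v; have [s _ ->] := gproj_sum v.
elim: s => [|n s IH]; first by rewrite big_nil.
rewrite big_cons -[gproj n v]scale1r; apply: PD => //; apply: (Ph n).
by rewrite /homog gproj_proj eqxx.
Qed.
End Gsum.

Section Mk.
Variables (V : lmodType K) (p : int -> V -> V).
Hypothesis lp : forall n, linear (p n).
Hypothesis hspan : forall P : V -> Prop, P 0 ->
  (forall a x y, P x -> P y -> P (a *: x + y)) ->
  (forall n v, (forall m, p m v = if m == n then v else 0) -> P v) -> forall v, P v.

Let p0 n : p n 0 = 0.
Proof. exact: lin0. Qed.

Lemma span_proj m n v : p m (p n v) = if m == n then p n v else 0.
Proof.
elim/hspan: v => [|a x y Hx Hy|k v Hv]; first by rewrite !p0 if_same.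
  by rewrite !lp Hx Hy; case: eqP => // _; rewrite scaler0 addr0.
rewrite !Hv; case: (eqVneq n k) => [->|nk]; first by rewrite Hv.
by rewrite p0 if_same.
Qed.

Let supp v := exists2 s : seq int, uniq s &
  (v = \sum_(n <- s) p n v) /\ (forall n, n \notin s -> p n v = 0).

Lemma span_sum v : exists2 s : seq int, uniq s & v = \sum_(n <- s) p n v.
Proof.
suff [s us [Es _]] : supp v by exists s.
elim/hspan: v => [|a x y [s us [Es Hs]] [t ut [Et Ht]]|k v Hv].
- by exists [::] => //; split=> [|n _]; rewrite ?big_nil // p0.
- pose r := undup (s ++ t); have ur : uniq r by exact: undup_uniq.
  have sub (q : seq int) z : uniq q -> {subset q <= r} ->
     (forall n, n \notin q -> p n z = 0) ->
     \sum_(n <- q) p n z = \sum_(n <- r) p n z.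
    move=> uq qr Hq; rewrite [RHS](bigID (mem q)) /= [X in _ + X]big1 ?addr0; last first.
      by move=> n /Hq.
    rewrite -[RHS]big_filter; apply: perm_big; apply: uniq_perm => //.
      exact: filter_uniq.
    by move=> n; rewrite mem_filter /= andb_idr // => /qr.
  have sr : {subset s <= r} by move=> n; rewrite mem_undup mem_cat => ->.
  have tr : {subset t <= r} by move=> n; rewrite mem_undup mem_cat orbC => ->.
  exists r => //; split=> [|n nr]; last first.
    rewrite lp Hs ?Ht ?scaler0 ?addr0 //.
      by apply: contra nr; exact: tr.
    by apply: contra nr; exact: sr.
  rewrite (eq_bigr (fun n => a *: p n x + p n y)); last by move=> n _; rewrite lp.
  by rewrite big_split -scaler_sumr -(sub s) // -(sub t) // -Es -Et.
- exists [:: k] => //; split=> [|n]; first by rewrite big_seq1 Hv eqxx.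
  by rewrite inE Hv => /negbTE ->.
Qed.
End Mk.

(* K is concentrated in degree 0. *)
Definition gproj_scalar (n : int) (x : K^o) : K^o := if n == 0 then x else 0.
Fact gproj_scalar_linear n : linear (gproj_scalar n).
Proof. by rewrite /gproj_scalar => a x y; case: eqP => // _; rewrite scaler0 addr0. Qed.
Fact gproj_scalar_span : forall P : K^o -> Prop, P 0 ->
  (forall a x y, P x -> P y -> P (a *: x + y)) ->
  (forall n v, (forall m, gproj_scalar m v = if m == n then v else 0) -> P v) -> forall v, P v.
Proof. by move=> P _ _ Ph v; apply: (Ph 0). Qed.
HB.instance Definition _ := isGraded.Build K K^o gproj_scalar_linear
  (span_proj gproj_scalar_linear gproj_scalar_span)
  (span_sum gproj_scalar_linear gproj_scalar_span).

(* (V (x) W)_m is the sum of the V_n (x) W_(m - n). *)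
Section TensorGrading.
Variables V W : gradedType K.

Let tlin1 w n : linear (fun v : V => v \ox gproj n (w : W)).
Proof. exact: (tens_bilin V W).1. Qed.

Fact gproj_tens_bilin m :
  bilin (fun (v : V) (w : W) => gsum (fun n v' => v' \ox gproj (m - n) w) v).
Proof.
split=> [w|v a w w']; first by apply: gsum_linear => n; exact: tlin1.
apply: gsum_comb => n; [exact: tlin1..|move=> x].
by rewrite linearP; exact: (tens_bilin V W).2.
Qed.
Definition gproj_tens m : tensor V W -> tensor V W := tens_lift (gproj_tens_bilin m).

Fact gproj_tens_linear m : linear (gproj_tens m).
Proof. exact: linearP. Qed.

Lemma gproj_tens_homog i j (v : V) (w : W) m : homog i v -> homog j w ->
  gproj_tens m (v \ox w) = if m == i + j then v \ox w else 0.
Proof.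
move=> hv hw; rewrite /gproj_tens tens_liftE (gsum_homog _ hv) => [|n]; last exact: tlin1.
rewrite -[w in LHS]hw gproj_proj subr_eq [j + i]addrC; case: eqP => _; first by rewrite hw.
exact: lin0 ((tens_bilin V W).2 v).
Qed.

Fact gproj_tens_span : forall P : tensor V W -> Prop, P 0 ->
  (forall a x y, P x -> P y -> P (a *: x + y)) ->
  (forall n v, (forall m, gproj_tens m v = if m == n then v else 0) -> P v) -> forall v, P v.
Proof.
move=> P P0 PD Ph; have [tl tr] := tens_bilin V W.
have t0l w : (0 : V) \ox w = (0 : tensor V W).
  exact: lin0 (tl w).
have t0r v : v \ox (0 : W) = (0 : tensor V W).
  exact: lin0 (tr v).
apply: tens_ind => // v w.
elim/graded_ind: v => [|a x y Hx Hy|i v hv]; first by rewrite t0l.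
  by rewrite tl; apply: PD.
elim/graded_ind: w => [|a x y Hx Hy|j w hw]; first by rewrite t0r.
  by rewrite tr; apply: PD.
by apply: (Ph (i + j)) => m; apply: gproj_tens_homog.
Qed.
HB.instance Definition _ := isGraded.Build K (tensor V W) gproj_tens_linear
  (span_proj gproj_tens_linear gproj_tens_span)
  (span_sum gproj_tens_linear gproj_tens_span).
End TensorGrading.

(* |x_1 ... x_k| = |x_1| + ... + |x_k| *)
Section TcoalgGrading.
Variable X : gradedType K.

Fixpoint gproj_word (w : seq X) (m : int) : tcoalg X :=
  if w is x :: w' then gsum (fun n x' => lcat [:: x'] (gproj_word w' (m - n))) x
  else if m == 0 then tone else 0.

Let lcat_lin (t : tcoalg X) : linear (fun x => lcat [:: x] t).
Proof. exact: (conc1_multilin t [::] [::]). Qed.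

Fact gproj_word_multilin m : multilin (gproj_word^~ m).
Proof.
move=> u v a x y; elim: u m => [|z u IH] m /=.
  by apply: gsum_linear => n; exact: lcat_lin.
apply: gsum_comb => n; [exact: lcat_lin..|move=> z'].
by rewrite IH linearP.
Qed.
Definition gproj_tcoalg m : tcoalg X -> tcoalg X := tword_lift (gproj_word_multilin m).

Fact gproj_tcoalg_linear m : linear (gproj_tcoalg m).
Proof. exact: linearP. Qed.

Lemma gproj_tcoalg_homog (w : seq X) : (forall x, x \in w -> exists n, homog n x) ->
  exists k, forall m, gproj_tcoalg m (tword w) = if m == k then tword w else 0.
Proof.
rewrite /gproj_tcoalg; elim: w => [|x w IH] hw.
  by exists 0 => m; rewrite tword_liftE.
have [|k Hk] := IH; first by move=> z zw; apply: hw; rewrite inE zw orbT.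
have [|n hx] := hw x; first exact: mem_head.
exists (n + k) => m; rewrite tword_liftE /= (gsum_homog _ hx) => [|i]; last exact: lcat_lin.
have := Hk (m - n); rewrite tword_liftE => ->.
rewrite subr_eq [k + n]addrC; case: eqP => _; last by rewrite linear0.
by rewrite /lcat tword_liftE.
Qed.

Fact gproj_tcoalg_span : forall P : tcoalg X -> Prop, P 0 ->
  (forall a x y, P x -> P y -> P (a *: x + y)) ->
  (forall n v, (forall m, gproj_tcoalg m v = if m == n then v else 0) -> P v) ->
  forall v, P v.
Proof.
move=> P P0 PD Ph; apply: tword_ind => // w.
suff H : forall u, (forall x, x \in u -> exists n, homog n x) -> P (tword (u ++ w)).
  exact: (H [::]).
elim: w => [|x w IH] u hu.
  have [k Hk] := gproj_tcoalg_homog hu; rewrite cats0; exact: Ph Hk.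
elim/graded_ind: x => [|a x y Hx Hy|i x hx].
- have -> : tword (u ++ 0 :: w) = 0; last by [].
  exact: (@lin0 _ _ _ (fun x : X => tword (u ++ x :: w)) (tword_multilin u w)).
- by rewrite tword_multilin; apply: PD.
rewrite -cat_rcons; apply: IH => z; rewrite mem_rcons inE => /orP[/eqP ->|/hu //].
by exists i.
Qed.
HB.instance Definition _ := isGraded.Build K (tcoalg X) gproj_tcoalg_linear
  (span_proj gproj_tcoalg_linear gproj_tcoalg_span)
  (span_sum gproj_tcoalg_linear gproj_tcoalg_span).
End TcoalgGrading.
End GradedTheory.

Section Koszul.
Variable K : fieldType.

Section Sign.
Variable V : gradedType K.
Variable e : int.

(* v |-> (-1)^(e |v|) v *)
Definition koszul : V -> V := gsum (fun n v => (-1 : K) ^ (e * n) *: v).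
Fact koszul_linear : linear koszul.
Proof. by apply: gsum_linear => n a x y; rewrite linearP. Qed.
HB.instance Definition _ := GRing.isLinear.Build K V V *:%R koszul koszul_linear.
End Sign.

(* The tensor product of f and g with the Koszul sign (-1)^(e |v|), for g of
   degree e. *)
Definition gtmap (V V' W W' : gradedType K) (e : int)
    (f : {linear V -> V'}) (g : {linear W -> W'}) : tensor V W -> tensor V' W' :=
  tmap (f \o koszul e) g.
HB.instance Definition _ V V' W W' e f g :=
  GRing.Linear.on (@gtmap V V' W W' e f g).

Section Braiding.
Variables V W : gradedType K.

Fact braid_bilin :
  bilin (fun (v : V) (w : W) => gsum (fun n v' => koszul n w \ox v') v).
Proof.
have [tl tr] := tens_bilin W V.
split=> [w|v a w w']; first by apply: gsum_linear => n; exact: tr.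
by apply: gsum_comb => n; [exact: tr..|move=> x]; rewrite linearP tl.
Qed.
(* v (x) w |-> (-1)^(|v| |w|) w (x) v *)
Definition braid : tensor V W -> tensor W V := tens_lift braid_bilin.
HB.instance Definition _ := GRing.Linear.on braid.
End Braiding.

Section Interchange.
Variables A B C D : gradedType K.
(* id (x) braid (x) id *)
Definition midswap : tensor (tensor A B) (tensor C D) -> tensor (tensor A C) (tensor B D) :=
  @tassocV K A C (tensor B D)
  \o tmap idfun (@tassoc K C B D)
  \o tmap idfun (tmap (@braid B C) idfun)
  \o tmap idfun (@tassocV K B C D)
  \o @tassoc K A B (tensor C D).
HB.instance Definition _ := GRing.Linear.on midswap.
End Interchange.
End Koszul.

Section Structures.
Variable K : fieldType.

Section Predicates.
Variable V : gradedType K.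

Definition unital_assoc (m : {linear tensor V V -> V}) (one : V) : Prop :=
  [/\ forall x y z, m (m (x \ox y) \ox z) = m (x \ox m (y \ox z)),
      forall x, m (one \ox x) = x & forall x, m (x \ox one) = x].

(* a coassociative counital graded coalgebra with a group-like element of
   degree 0 *)
Definition unital_coalgebra (D : {linear V -> tensor V V})
    (e : {linear V -> K^o}) (one : V) : Prop :=
  [/\ of_degree 0 D /\ of_degree 0 e,
      forall x, tassoc (tmap D idfun (D x)) = tmap idfun D (D x),
      forall x, tmap e idfun (D x) = (1 : K^o) \ox x,
      forall x, tmap idfun e (D x) = x \ox (1 : K^o) &
      [/\ homog 0 one, D one = one \ox one & e one = 1]].

Definition coderivation (D : {linear V -> tensor V V}) (d : {linear V -> V}) : Prop :=
  forall x, D (d x) = tmap d idfun (D x) + gtmap (-1) idfun d (D x).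

Definition derivation (m : {linear tensor V V -> V}) (d : {linear V -> V}) : Prop :=
  forall x, d (m x) = m (tmap d idfun x + gtmap (-1) idfun d x).

Definition differential (d : {linear V -> V}) : Prop :=
  of_degree (-1) d /\ forall x, d (d x) = 0.

Definition tens_comul (D : {linear V -> tensor V V}) :
    tensor V V -> tensor (tensor V V) (tensor V V) :=
  @midswap K V V V V \o tmap D D.

(* m : V (x) V -> V is a coalgebra map, the counit of V (x) V being
   x (x) y |-> e(x) e(y). *)
Definition mul_coalg_map (D : {linear V -> tensor V V}) (e : {linear V -> K^o})
   (m : {linear tensor V V -> V}) : Prop :=
  [/\ of_degree 0 m,
      forall t, D (m t) = tmap m m (tens_comul D t)
    & forall x y, e (m (x \ox y)) = e x * e y].
End Predicates.
End Structures.

Record binf_alg (K : fieldType) := BinfAlg {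
  binf_sort :> gradedType K;
  binf_mul : {linear tensor (tcoalg binf_sort) (tcoalg binf_sort) -> tcoalg binf_sort};
  binf_diff : {linear tcoalg binf_sort -> tcoalg binf_sort};
  binf_mul_coalg : mul_coalg_map deconc tcounit binf_mul;
  binf_mul_unital : unital_assoc binf_mul tone;
  binf_differential : differential binf_diff;
  binf_coderivation : coderivation deconc binf_diff;
  binf_diff1 : binf_diff tone = 0;
  binf_derivation : derivation binf_mul binf_diff
}.

(* The structure maps m_n and m_{i,j}, as multilinear maps: a linear map on
   X^(x)n is determined by its values on pure tensors. *)
Definition binf_m (K : fieldType) (A : binf_alg K) (n : nat) (w : n.-tuple A) : A :=
  tproj1 (binf_diff A (tword w)).
Definition binf_mm (K : fieldType) (A : binf_alg K) (i j : nat)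
    (u : i.-tuple A) (v : j.-tuple A) : A :=
  tproj1 (binf_mul A (tword u \ox tword v)).

Record binf_hom (K : fieldType) (A B : binf_alg K) := BinfHom {
  binf_fun :> {linear A -> B};
  binf_fun_deg : of_degree 0 binf_fun;
  binf_fun_m : forall n (w : n.-tuple A), (0 < n)%N ->
    binf_fun (binf_m w) = binf_m (map_tuple binf_fun w);
  binf_fun_mm : forall i j (u : i.-tuple A) (v : j.-tuple A), (0 < i)%N -> (0 < j)%N ->
    binf_fun (binf_mm u v) = binf_mm (map_tuple binf_fun u) (map_tuple binf_fun v)
}.

Record two_as_data (K : fieldType) := TwoAsData {
  ta_sort :> gradedType K;
  ta_diff : {linear ta_sort -> ta_sort};
  ta_bul : {linear tensor ta_sort ta_sort -> ta_sort};
  ta_odot : {linear tensor ta_sort ta_sort -> ta_sort};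
  ta_one : ta_sort
}.

Definition two_as_dalg (K : fieldType) (V : two_as_data K) : Prop :=
  [/\ [/\ of_degree 0 (ta_bul V), of_degree 0 (ta_odot V) & homog 0 (ta_one V)],
      unital_assoc (ta_bul V) (ta_one V),
      unital_assoc (ta_odot V) (ta_one V),
      differential (ta_diff V)
    & derivation (ta_bul V) (ta_diff V)].

Record bialg_data (K : fieldType) := BialgData {
  bd_alg :> two_as_data K;
  bd_comul : {linear bd_alg -> tensor bd_alg bd_alg};
  bd_counit : {linear bd_alg -> K^o}
}.

(* Delta (x o y) = x1 (x) (x2 o y) + (x o y1) (x) y2 - x (x) y *)
Definition unital_infinitesimal (K : fieldType) (V : gradedType K)
    (m : {linear tensor V V -> V}) (D : {linear V -> tensor V V}) : Prop :=
  forall t, D (m t) = tmap idfun m (tassoc (tmap D idfun t))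
                    + tmap m idfun (tassocV (tmap idfun D t)) - t.

(* The conditions d(1) = 0 and e d = 0 are consequences of the derivation and
   coderivation properties. *)
Definition two_as_dbialg (K : fieldType) (V : bialg_data K) : Prop :=
  [/\ two_as_dalg V,
      unital_coalgebra (bd_comul V) (bd_counit V) (ta_one V),
      mul_coalg_map (bd_comul V) (bd_counit V) (ta_bul V),
      coderivation (bd_comul V) (ta_diff V)
    & unital_infinitesimal (ta_odot V) (bd_comul V)].

Record bialg (K : fieldType) := Bialg {
  bialg_car :> bialg_data K;
  bialgP : two_as_dbialg bialg_car
}.

Definition is_bialg_hom (K : fieldType) (V W : bialg_data K) (f : {linear V -> W}) : Prop :=
  [/\ of_degree 0 f,
      forall x, f (ta_diff V x) = ta_diff W (f x),
      [/\ forall t, f (ta_bul V t) = ta_bul W (tmap f f t),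
          forall t, f (ta_odot V t) = ta_odot W (tmap f f t)
        & f (ta_one V) = ta_one W],
      forall x, bd_comul W (f x) = tmap f f (bd_comul V x)
    & forall x, bd_counit W (f x) = bd_counit V x].

Record bialg_hom (K : fieldType) (V W : bialg_data K) := BialgHom {
  bialg_fun :> {linear V -> W};
  bialg_homP : is_bialg_hom bialg_fun
}.

Definition cofree (K : fieldType) (V : bialg_data K) : Prop :=
  exists (X : gradedType K) (f : {linear V -> tcoalg X}),
  [/\ bijective f, of_degree 0 f,
      forall x, deconc (f x) = tmap f f (bd_comul V x),
      forall x, tcounit (f x) = bd_counit V x
    & f (ta_one V) = tone].

Definition U_alg (K : fieldType) (A : binf_alg K) : two_as_data K :=
  @TwoAsData K (tcoalg A) (binf_diff A) (binf_mul A) conc tone.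

Definition U_bialg (K : fieldType) (A : binf_alg K) : bialg_data K :=
  @BialgData K (U_alg A) deconc tcounit.

Record category := Category {
  cat_obj :> Type;
  cat_hom : cat_obj -> cat_obj -> Type;
  cat_id : forall a, cat_hom a a;
  cat_comp : forall a b c, cat_hom b c -> cat_hom a b -> cat_hom a c;
  cat_idl : forall a b (f : cat_hom a b), cat_comp (cat_id b) f = f;
  cat_idr : forall a b (f : cat_hom a b), cat_comp f (cat_id a) = f;
  cat_compA : forall a b c d (h : cat_hom c d) (g : cat_hom b c) (f : cat_hom a b),
    cat_comp h (cat_comp g f) = cat_comp (cat_comp h g) f
}.

Definition is_functor (C D : category) (F : C -> D)
    (Fm : forall a b : C, cat_hom a b -> cat_hom (F a) (F b)) : Prop :=
  (forall a, Fm a a (cat_id a) = cat_id (F a)) /\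
  (forall a b c (g : cat_hom b c) (f : cat_hom a b),
     Fm a c (cat_comp g f) = cat_comp (Fm b c g) (Fm a b f)).

Lemma linear_eq (K : fieldType) (V W : lmodType K) (f g : {linear V -> W}) :
  f =1 g -> f = g.
Proof.
case: f g => f [[f1] [f2]] [g [[g1] [g2]]] /= /funext E; subst g.
by congr (GRing.Linear.Pack (GRing.Linear.Class _ _));
   congr (_ _); apply: Prop_irrelevance.
Qed.

Section Categories.
Variable K : fieldType.

Lemma binf_hom_eq (A B : binf_alg K) (f g : binf_hom A B) : f =1 g -> f = g.
Proof.
case: f g => f f1 f2 f3 [g g1 g2 g3] /= /linear_eq E; subst g.
by congr BinfHom; exact: Prop_irrelevance.
Qed.

Lemma bialg_hom_eq (V W : bialg_data K) (f g : bialg_hom V W) : f =1 g -> f = g.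
Proof.
case: f g => f fP [g gP] /= /linear_eq E; subst g.
by congr BialgHom; exact: Prop_irrelevance.
Qed.

Lemma of_degree0_comp (U V W : gradedType K) (g : V -> W) (f : U -> V) :
  of_degree 0 g -> of_degree 0 f -> of_degree 0 (g \o f).
Proof. by move=> hg hf n v /hf/hg; rewrite !addr0. Qed.

Lemma of_degree0_id (V : gradedType K) : of_degree 0 (idfun : V -> V).
Proof. by move=> n v; rewrite addr0. Qed.

Lemma tmap_comp (V V' V'' W W' W'' : lmodType K) (f' : {linear V' -> V''})
    (g' : {linear W' -> W''}) (f : {linear V -> V'}) (g : {linear W -> W'}) t :
  tmap (f' \o f) (g' \o g) t = tmap f' g' (tmap f g t).
Proof.
elim/tens_ind: t => [|a x y Hx Hy|v w]; first by rewrite !linear0.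
  by rewrite !linearP /= Hx Hy.
by rewrite !tmapE.
Qed.

Lemma tmap_id (V W : lmodType K) (t : tensor V W) : tmap idfun idfun t = t.
Proof.
elim/tens_ind: t => [|a x y Hx Hy|v w]; first by rewrite linear0.
  by rewrite linearP /= Hx Hy.
by rewrite tmapE.
Qed.

Section BinfCat.
Fact binf_id_m (A : binf_alg K) n (w : n.-tuple A) : (0 < n)%N ->
  idfun (binf_m w) = binf_m (map_tuple (idfun : A -> A) w).
Proof. by rewrite /binf_m /= map_id. Qed.
Fact binf_id_mm (A : binf_alg K) i j (u : i.-tuple A) (v : j.-tuple A) :
  (0 < i)%N -> (0 < j)%N ->
  idfun (binf_mm u v) = binf_mm (map_tuple (idfun : A -> A) u) (map_tuple (idfun : A -> A) v).
Proof. by rewrite /binf_mm /= !map_id. Qed.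
Definition binf_id (A : binf_alg K) : binf_hom A A :=
  @BinfHom K A A idfun (@of_degree0_id A) (@binf_id_m A) (@binf_id_mm A).

Variables (A B C : binf_alg K) (g : binf_hom B C) (f : binf_hom A B).
Fact binf_comp_m n (w : n.-tuple A) : (0 < n)%N ->
  (g \o f) (binf_m w) = binf_m (map_tuple (g \o f) w).
Proof.
move=> n0; rewrite /= (binf_fun_m f w n0) (binf_fun_m g _ n0).
by congr binf_m; apply: val_inj; rewrite /= map_comp.
Qed.
Fact binf_comp_mm i j (u : i.-tuple A) (v : j.-tuple A) : (0 < i)%N -> (0 < j)%N ->
  (g \o f) (binf_mm u v) = binf_mm (map_tuple (g \o f) u) (map_tuple (g \o f) v).
Proof.
move=> i0 j0; rewrite /= (binf_fun_mm f u v i0 j0) (binf_fun_mm g _ _ i0 j0).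
by congr binf_mm; apply: val_inj; rewrite /= map_comp.
Qed.
Definition binf_comp : binf_hom A C :=
  @BinfHom K A C (g \o f) (of_degree0_comp (binf_fun_deg g) (binf_fun_deg f))
    binf_comp_m binf_comp_mm.
End BinfCat.

Definition binf_cat : category.
Proof.
refine (@Category (binf_alg K) (@binf_hom K) binf_id binf_comp _ _ _).
- by move=> A B f; apply: binf_hom_eq.
- by move=> A B f; apply: binf_hom_eq.
- by move=> A B C D h g f; apply: binf_hom_eq.
Defined.

Section BialgCat.
Fact bialg_id_hom (V : bialg_data K) : is_bialg_hom (W := V) (idfun : {linear V -> V}).
Proof.
split=> //; first exact: of_degree0_id.
  by split=> // t; rewrite tmap_id.
by move=> x; rewrite tmap_id.
Qed.
Definition bialg_id (V : bialg_data K) : bialg_hom V V := BialgHom (bialg_id_hom V).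

Variables (U V W : bialg_data K) (g : bialg_hom V W) (f : bialg_hom U V).
Fact bialg_comp_hom : is_bialg_hom (V := U) (W := W) (g \o f).
Proof.
case: g f => g' [gd gD [gb go g1] gc ge] [f' [fd fD [fb fo f1] fc fe]] /=.
split; first exact: of_degree0_comp.
- by move=> x /=; rewrite fD gD.
- by split=> [t|t|] /=; rewrite ?tmap_comp ?fb ?gb ?fo ?go ?f1 ?g1.
- by move=> x /=; rewrite gc fc tmap_comp.
- by move=> x /=; rewrite ge fe.
Qed.
Definition bialg_comp : bialg_hom U W := BialgHom bialg_comp_hom.
End BialgCat.

Definition bialg_cat : category.
Proof.
refine (@Category (bialg K) (fun V W => bialg_hom V W) (fun V => bialg_id V)
  (fun _ _ _ g f => bialg_comp g f) _ _ _).
- by move=> V W f; apply: bialg_hom_eq.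
- by move=> V W f; apply: bialg_hom_eq.
- by move=> V W X Y h g f; apply: bialg_hom_eq.
Defined.
End Categories.

(* Main.v *)
From HB Require Import structures.
Require Import Defs.
From mathcomp Require Import all_boot all_order all_algebra.

(** The bialgebra axioms split in two. Those that involve only concatenation and
    deconcatenation hold for every tensor coalgebra and are proved on words by
    induction, from
      Delta (x w) = 1 (x) x w + (x . (x) id) (Delta w)     (deconc_cons).
    Those that involve the product or the differential are part of the definition
    of a B-infinity algebra. Cofreeness is witnessed by the identity. Degrees are
    controlled on words with homogeneous letters (hword), which span.

    The substance is that T^c(f) commutes with the differentials and the products,
    when f is only known to commute with the structure maps, which are their
    projections to words of length one. The reason is the universal property of
    T^c(Y) among conilpotent coalgebras: a coalgebra map into it is determined by
    its projection to Y. In concrete terms, every element satisfies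
      t = eps(t) 1 + sum p_1(t_1) . t_2                    (head_recursion),
    so that for a coalgebra map F, the value F(t) is given by the counit, p_1 F,
    and the values F(t_2) with t_2 strictly shorter than t: the only term where
    t_2 = t has t_1 = 1, and p_1 (F 1) = 0. The same recursion handles
    coderivations along T^c(f). Both T^c(f) d and d T^c(f) are such coderivations,
    both T^c(f) mu and mu (T^c(f) (x) T^c(f)) are coalgebra maps, and in each pair
    the projections agree because f preserves the structure maps
    (coder_along_unique, coalg_map_unique). *)

Set Implicit Arguments.
Unset Strict Implicit.
Unset Printing Implicit Defensive.

Import GRing.Theory.
Local Open Scope ring_scope.

(** * Tensor products *)

Section Linear.
Variable K : fieldType.

Lemma tens_linearl (V W : lmodType K) a (v v' : V) (w : W) :
  (a *: v + v') \ox w = a *: (v \ox w) + v' \ox w.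
Proof. exact: (tens_bilin V W).1. Qed.

Lemma tens_linearr (V W : lmodType K) (v : V) a (w w' : W) :
  v \ox (a *: w + w') = a *: (v \ox w) + v \ox w'.
Proof. exact: (tens_bilin V W).2. Qed.

HB.instance Definition _ (V W : lmodType K) (v : V) :=
  GRing.isLinear.Build K W (tensor V W) *:%R (tens v) (tens_linearr v).
(** The arguments are swapped so that the partial application, linear in v, can
    carry a linear structure. *)
Definition tensl (V W : lmodType K) (w : W) (v : V) : tensor V W := v \ox w.
HB.instance Definition _ (V W : lmodType K) (w : W) :=
  GRing.isLinear.Build K V (tensor V W) *:%R (tensl w) (fun a v v' => tens_linearl a v v' w).

Lemma tens0l (V W : lmodType K) (w : W) : (0 : V) \ox w = 0.
Proof. by apply: (lin0 (f := fun v : V => v \ox w)) => a v v'; exact: tens_linearl. Qed.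

Lemma tens0r (V W : lmodType K) (v : V) : v \ox (0 : W) = 0.
Proof. by apply: (lin0 (f := fun w : W => v \ox w)) => a w w'; exact: tens_linearr. Qed.

Lemma tensZl (V W : lmodType K) a (v : V) (w : W) : (a *: v) \ox w = a *: (v \ox w).
Proof. by rewrite -[a *: v]addr0 tens_linearl tens0l addr0. Qed.

Lemma tensDl (V W : lmodType K) (v v' : V) (w : W) : (v + v') \ox w = v \ox w + v' \ox w.
Proof. by rewrite -{1}[v]scale1r tens_linearl scale1r. Qed.

Lemma tensDr (V W : lmodType K) (v : V) (w w' : W) : v \ox (w + w') = v \ox w + v \ox w'.
Proof. by rewrite -{1}[w]scale1r tens_linearr scale1r. Qed.

Lemma tens_suml (V W : lmodType K) (I : Type) (r : seq I) (F : I -> V) (w : W) :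
  (\sum_(i <- r) F i) \ox w = \sum_(i <- r) F i \ox w.
Proof. exact: (linear_sum (tensl w)). Qed.

Lemma tmap_swap (V V' W W' : lmodType K) (f : {linear V -> V'}) (g : {linear W -> W'}) t :
  tmap idfun g (tmap f idfun t) = tmap f idfun (tmap idfun g t).
Proof.
elim/tens_ind: t => [|a x y Hx Hy|v w]; first by rewrite !linear0.
  by rewrite !linearP /= Hx Hy.
by rewrite !tmapE.
Qed.

Lemma tmap_tmap_id (U V V' W : lmodType K) (f : {linear U -> V}) (t : tensor U (tensor V' W)) :
  tmap f (tmap idfun idfun) t = tmap f idfun t.
Proof.
elim/tens_ind: t => [|a x y Hx Hy|v w]; first by rewrite !linear0.
  by rewrite !linearP /= Hx Hy.
by rewrite !tmapE /= tmap_id.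
Qed.

Lemma tassoc_nat (V1 V2 V3 W1 W2 W3 : lmodType K) (f : {linear V1 -> W1})
    (g : {linear V2 -> W2}) (h : {linear V3 -> W3}) t :
  tassoc (tmap (tmap f g) h t) = tmap f (tmap g h) (tassoc t).
Proof.
elim/tens_ind: t => [|a x y Hx Hy|t w]; rewrite ?linear0 ?linearP /= ?Hx ?Hy //.
elim/tens_ind: t => [|a x y Hx Hy|u v]; first by rewrite tens0l !linear0.
  by rewrite tens_linearl !linearP /= Hx Hy.
by do 3!rewrite ?tassocE ?tmapE /=.
Qed.

End Linear.

(** * Concatenation and deconcatenation *)

Section Deconcatenation.
Variable K : fieldType.
Variable X : lmodType K.
Implicit Types (w : seq X) (t : tcoalg X).

Lemma lcatE u w : lcat u (tword w) = tword (u ++ w).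
Proof. exact: tword_liftE. Qed.

Lemma tproj1E w : tproj1 (tword w) = if w is [:: x] then x else 0.
Proof. exact: tword_liftE. Qed.

Lemma tcounitE w : tcounit (tword w) = (nilp w)%:R.
Proof. exact: tword_liftE. Qed.

Lemma deconcE w :
  deconc (tword w) = \sum_(i < (size w).+1) tword (take i w) \ox tword (drop i w).
Proof. exact: tword_liftE. Qed.

Lemma deconc_nil : deconc tone = tone \ox tone :> tensor (tcoalg X) _.
Proof. by rewrite deconcE big_ord1. Qed.

Lemma deconc_cons x w : deconc (tword (x :: w)) =
  tone \ox tword (x :: w) + tmap (lcat [:: x]) idfun (deconc (tword w)).
Proof.
rewrite !deconcE big_ord_recl linear_sum /=; congr (_ + _).
by apply: eq_bigr => i _; rewrite tmapE /= lcatE.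
Qed.

Lemma deconc_lcat x t : deconc (lcat [:: x] t) =
  tone \ox lcat [:: x] t + tmap (lcat [:: x]) idfun (deconc t).
Proof.
elim/tword_ind: t => [|a y z Hy Hz|w]; last by rewrite lcatE deconc_cons.
  by rewrite !linear0 addr0.
by rewrite !linearP /= Hy Hz scalerDr addrACA.
Qed.

(** The inductive step of coassociativity: prefixing the first factor by x and then
    splitting that factor again creates one new term, with the empty prefix. *)
Lemma tassoc_deconc_lcat (x : X) (t : tensor (tcoalg X) (tcoalg X)) :
  tassoc (tmap deconc idfun (tmap (lcat [:: x]) idfun t)) =
  tone \ox tmap (lcat [:: x]) idfun t +
  tmap (lcat [:: x]) idfun (tassoc (tmap deconc idfun t)).
Proof.
elim/tens_ind: t => [|a y z Hy Hz|u v].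
- by rewrite !linear0 addr0.
- by rewrite !linearP /= Hy Hz scalerDr addrACA.
rewrite !tmapE /= deconc_lcat tensDl linearD /= tassocE; congr (_ + _).
have -> : tmap (lcat [:: x]) idfun (deconc u) \ox v =
   tmap (tmap (lcat [:: x]) idfun) idfun (deconc u \ox v) by rewrite tmapE.
by rewrite tassoc_nat tmap_tmap_id.
Qed.

Lemma deconc_coassoc t :
  tassoc (tmap deconc idfun (deconc t)) = tmap idfun deconc (deconc t).
Proof.
elim/tword_ind: t => [|a y z Hy Hz|w]; first by rewrite !linear0.
  by rewrite !linearP /= Hy Hz.
elim: w => [|x w IH]; first by rewrite deconc_nil !tmapE /= deconc_nil tassocE.
rewrite deconc_cons !linearD /= tassoc_deconc_lcat tmap_swap -IH !tmapE /=.
by rewrite deconc_nil tassocE deconc_cons tensDr addrA.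
Qed.

Lemma deconc_counitl t : tmap tcounit idfun (deconc t) = (1 : K^o) \ox t.
Proof.
elim/tword_ind: t => [|a y z Hy Hz|w]; first by rewrite !linear0.
  by rewrite !linearP /= Hy Hz.
case: w => [|x w]; first by rewrite deconc_nil tmapE /= tcounitE.
rewrite deconc_cons linearD /= tmapE /= tcounitE; move: (deconc _) => t.
suff -> : tmap tcounit idfun (tmap (lcat [:: x]) idfun t) = 0 by rewrite addr0.
rewrite -tmap_comp.
elim/tens_ind: t => [|a y z Hy Hz|s t]; first by rewrite !linear0.
  by rewrite !linearP /= Hy Hz scaler0 addr0.
rewrite tmapE /=; suff -> : tcounit (lcat [:: x] s) = 0 by rewrite tens0l.
elim/tword_ind: s => [|a y z Hy Hz|u]; first by rewrite !linear0.
  by rewrite !linearP /= Hy Hz scaler0 addr0.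
by rewrite lcatE tcounitE.
Qed.

Lemma deconc_counitr t : tmap idfun tcounit (deconc t) = t \ox (1 : K^o).
Proof.
elim/tword_ind: t => [|a y z Hy Hz|w]; first by rewrite !linear0 tens0l.
  by rewrite !linearP /= Hy Hz tens_linearl.
elim: w => [|x w IH]; first by rewrite deconc_nil tmapE /= tcounitE.
rewrite deconc_cons linearD /= tmapE /= tcounitE tmap_swap IH tens0r add0r.
by rewrite tmapE /= lcatE.
Qed.

Lemma conc1l t : conc (tone \ox t) = t.
Proof.
elim/tword_ind: t => [|a y z Hy Hz|w]; first by rewrite !linear0.
  by rewrite !linearP /= Hy Hz.
by rewrite concE.
Qed.

Lemma conc1r t : conc (t \ox tone) = t.
Proof.
elim/tword_ind: t => [|a y z Hy Hz|w]; first by rewrite tens0l linear0.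
  by rewrite tens_linearl linearP /= Hy Hz.
by rewrite concE cats0.
Qed.

Lemma concA (s t r : tcoalg X) : conc (conc (s \ox t) \ox r) = conc (s \ox conc (t \ox r)).
Proof.
elim/tword_ind: s => [|a y z Hy Hz|u]; first by rewrite !(tens0l, linear0).
  by rewrite !(tens_linearl, linearP) /= Hy Hz.
elim/tword_ind: t => [|a y z Hy Hz|v]; first by rewrite !(tens0l, linear0).
  by rewrite !(tens_linearl, linearP) /= Hy Hz.
elim/tword_ind: r => [|a y z Hy Hz|w]; first by rewrite !linear0.
  by rewrite !linearP /= Hy Hz.
by rewrite !concE catA.
Qed.

Lemma conc_lcat u s t : conc (lcat u s \ox t) = lcat u (conc (s \ox t)).
Proof.
elim/tword_ind: s => [|a y z Hy Hz|v]; first by rewrite !(tens0l, linear0).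
  by rewrite !(tens_linearl, linearP) /= Hy Hz.
elim/tword_ind: t => [|a y z Hy Hz|w]; first by rewrite !linear0.
  by rewrite !linearP /= Hy Hz.
by rewrite !(lcatE, concE) catA.
Qed.

(** Here T (x) T is a bimodule over T, which acts by concatenation on the outer
    sides of the two factors; the infinitesimal relation is written with these two
    actions, and an induction on words needs their values on prefixed words. *)
Lemma conc_left_tone (t : tensor (tcoalg X) (tcoalg X)) :
  tmap conc idfun (tassocV (tone \ox t)) = t.
Proof.
elim/tens_ind: t => [|a y z Hy Hz|s t]; first by rewrite !linear0.
  by rewrite !linearP /= Hy Hz.
by rewrite tassocVE tmapE /= conc1l.
Qed.

Lemma conc_left_lcat u s (t : tensor (tcoalg X) (tcoalg X)) :
  tmap conc idfun (tassocV (lcat u s \ox t)) =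
  tmap (lcat u) idfun (tmap conc idfun (tassocV (s \ox t))).
Proof.
elim/tens_ind: t => [|a y z Hy Hz|r t]; first by rewrite !linear0.
  by rewrite !linearP /= Hy Hz.
by rewrite !tassocVE !tmapE /= conc_lcat.
Qed.

Lemma conc_right_lcat u t (s : tensor (tcoalg X) (tcoalg X)) :
  tmap idfun conc (tassoc (tmap (lcat u) idfun s \ox t)) =
  tmap (lcat u) idfun (tmap idfun conc (tassoc (s \ox t))).
Proof.
elim/tens_ind: s => [|a y z Hy Hz|s r]; first by rewrite !(tens0l, linear0).
  by rewrite !(tens_linearl, linearP) /= Hy Hz.
by rewrite tmapE !tassocE !tmapE.
Qed.

(** Cutting u v inside u or inside v gives the two actions, and the cut between u
    and v is counted twice, whence the correction. The induction on u peels off one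
    letter at a time with deconc_cons. *)
Lemma deconc_conc (t : tensor (tcoalg X) (tcoalg X)) :
  deconc (conc t) = tmap idfun conc (tassoc (tmap deconc idfun t))
    + tmap conc idfun (tassocV (tmap idfun deconc t)) - t.
Proof.
elim/tens_ind: t => [|a y z Hy Hz|s t]; first by rewrite !linear0 !addr0.
  rewrite !linearP /= Hy Hz.
  by rewrite !scalerDr addrACA; congr (_ + _); rewrite addrACA.
elim/tword_ind: t => [|a y z Hy Hz|v]; first by rewrite !linear0 !addr0.
  rewrite !linearP /= Hy Hz.
  by rewrite !scalerDr addrACA; congr (_ + _); rewrite addrACA.
elim/tword_ind: s => [|a y z Hy Hz|u].
- by rewrite !(tens0l, linear0) !addr0.
- rewrite !(tens_linearl, linearP) /= Hy Hz.
  by rewrite !scalerDr addrACA; congr (_ + _); rewrite addrACA.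
rewrite concE !tmapE /=.
elim: u => [|x u IH].
  by rewrite conc_left_tone deconc_nil tassocE tmapE /= concE addrAC subrr add0r.
have Ex : tword (x :: u) = lcat [:: x] (tword u) by rewrite lcatE.
rewrite cat_cons deconc_cons IH [in RHS]deconc_cons tensDl [tassoc (_ + _)]linearD /=.
rewrite [tmap idfun conc (_ + _)]linearD /=.
rewrite tassocE tmapE /= concE conc_right_lcat Ex conc_left_lcat.
have -> : lcat [:: x] (tword u) \ox tword v = tmap (lcat [:: x]) idfun (tword u \ox tword v).
  by rewrite tmapE.
by rewrite !linearD /= !linearN /= !addrA.
Qed.
End Deconcatenation.

(** * Degrees and Koszul signs *)

Section Degrees.
Variable K : fieldType.

Lemma homog0 (V : gradedType K) n : homog n (0 : V).
Proof. exact: linear0. Qed.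

Lemma homog_comb (V : gradedType K) n a (x y : V) :
  homog n x -> homog n y -> homog n (a *: x + y).
Proof. by rewrite /homog linearP /= => -> ->. Qed.

Lemma homog_sum (V : gradedType K) n (I : Type) (r : seq I) (F : I -> V) :
  (forall i, homog n (F i)) -> homog n (\sum_(i <- r) F i).
Proof. by move=> hF; rewrite /homog linear_sum; apply: eq_bigr => i _; exact: hF. Qed.

Lemma homog_tens (V W : gradedType K) i j (v : V) (w : W) :
  homog i v -> homog j w -> homog (i + j) (v \ox w).
Proof. by move=> hv hw; have := gproj_tens_homog (i + j) hv hw; rewrite eqxx. Qed.

(** It suffices to control the degree on a spanning family G of homogeneous
    elements: a homogeneous v is its own projection, and the projection of a member
    of G is that member or 0. *)
Lemma of_degree_span (V W : gradedType K) (F : {linear V -> W}) (G : int -> V -> Prop) :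
  (forall n v, G n v -> homog n v) ->
  (forall P : V -> Prop, P 0 -> (forall a x y, P x -> P y -> P (a *: x + y)) ->
     (forall n v, G n v -> P v) -> forall v, P v) ->
  (forall n v, G n v -> homog n (F v)) -> of_degree 0 F.
Proof.
move=> hG indG hF n v <-; rewrite addr0.
elim/indG: v => [|a x y Hx Hy|m v Gv]; first by rewrite !linear0; exact: homog0.
  by rewrite !linearP; exact: homog_comb.
rewrite -(hG _ _ Gv) gproj_proj; case: eqP => [->|_]; last by rewrite linear0; exact: homog0.
by rewrite (hG _ _ Gv); exact: hF.
Qed.

Lemma koszul_homog (V : gradedType K) e n (v : V) :
  homog n v -> koszul e v = (-1 : K) ^ (e * n) *: v.
Proof. by move=> hv; rewrite /koszul (gsum_homog _ hv) // => m a x y; rewrite linearP. Qed.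

Lemma koszul_nat (V W : gradedType K) (f : {linear V -> W}) e v :
  of_degree 0 f -> koszul e (f v) = f (koszul e v).
Proof.
move=> hf; elim/graded_ind: v => [|a x y Hx Hy|n v hv]; first by rewrite !linear0.
  by rewrite !linearP /= Hx Hy.
have := hf _ _ hv; rewrite addr0 => hfv.
by rewrite (koszul_homog _ hv) (koszul_homog _ hfv) linearZ.
Qed.

Lemma braid_homog (V W : gradedType K) i j (v : V) (w : W) :
  homog i v -> homog j w -> braid (v \ox w) = (-1 : K) ^ (i * j) *: (w \ox v).
Proof.
move=> hv hw; rewrite /braid tens_liftE (gsum_homog _ hv) => [|n]; last first.
  exact: (tens_bilin W V).2.
by rewrite (koszul_homog _ hw) tensZl.
Qed.

(** Only the two middle factors need a degree: they alone are exchanged. *)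
Lemma midswapE (A B C D : gradedType K) i j (a : A) (b : B) (c : C) (d : D) :
  homog i b -> homog j c ->
  midswap (a \ox b \ox (c \ox d)) = (-1 : K) ^ (i * j) *: (a \ox c \ox (b \ox d)).
Proof.
move=> hb hc; rewrite /midswap /= tassocE tmapE /= tassocVE !tmapE /= tmapE /=.
by rewrite (braid_homog hb hc) tensZl linearZ /= tassocE !linearZ /= tassocVE.
Qed.

Lemma midswap_nat (A B C D A' B' C' D' : gradedType K) (f : {linear A -> A'})
    (g : {linear B -> B'}) (h : {linear C -> C'}) (k : {linear D -> D'}) t :
  of_degree 0 g -> of_degree 0 h ->
  midswap (tmap (tmap f g) (tmap h k) t) = tmap (tmap f h) (tmap g k) (midswap t).
Proof.
move=> hg hh.
elim/tens_ind: t => [|e x y Hx Hy|s t]; first by rewrite !linear0.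
  by rewrite !linearP /= Hx Hy.
elim/tens_ind: s => [|e x y Hx Hy|a b]; first by rewrite !(tens0l, linear0).
  by rewrite !(tens_linearl, linearP) /= Hx Hy.
elim/tens_ind: t => [|e x y Hx Hy|c d]; first by rewrite !linear0.
  by rewrite !linearP /= Hx Hy.
elim/graded_ind: b => [|e x y Hx Hy|i b hb]; first by rewrite !(tens0l, linear0).
  by rewrite !(tens_linearl, linearP) /= Hx Hy.
elim/graded_ind: c => [|e x y Hx Hy|j c hc]; first by rewrite !(tens0l, linear0).
  by rewrite !(tens_linearl, linearP) /= Hx Hy.
have := hg _ _ hb; have := hh _ _ hc; rewrite !addr0 => hhc hgb.
rewrite !tmapE /= !tmapE (midswapE _ _ hb hc) (midswapE _ _ hgb hhc) linearZ /=.
by rewrite !tmapE /= !tmapE.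
Qed.

Section Words.
Variable X : gradedType K.

(** On words with homogeneous letters the Koszul signs are scalars, and subwords
    are again of this form. The degree is an index and not a function of the word,
    because the zero letter is homogeneous of every degree. *)
Inductive hword : int -> seq X -> Prop :=
| hword_nil : hword 0 [::]
| hword_cons n k x w : homog n x -> hword k w -> hword (n + k) (x :: w).

Lemma hword_homog k w : hword k w -> homog k (tword w).
Proof.
elim=> [|n {}k x {}w hx _ IH]; rewrite /homog /gproj /= /gproj_tcoalg tword_liftE //=.
rewrite (gsum_homog _ hx) => [|i]; last exact: (conc1_multilin _ [::] [::]).
rewrite addrC addKr.
have := IH; rewrite /homog /gproj /= /gproj_tcoalg tword_liftE => ->.
by rewrite lcatE.
Qed.

Lemma hword_cat j k u v : hword j u -> hword k v -> hword (j + k) (u ++ v).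
Proof.
by elim=> [|n {}j x {}u hx _ IH] hv /=; rewrite ?add0r // -addrA; constructor; auto.
Qed.

Lemma hword_split k w i : hword k w ->
  exists2 m, hword m (take i w) & hword (k - m) (drop i w).
Proof.
move=> hw; elim: hw i => [|n {}k x {}w hx hw IH] [|i] /=.
- by exists 0; rewrite ?subr0; constructor.
- by exists 0; rewrite ?subr0; constructor.
- by exists 0; rewrite ?subr0; constructor.
by have [m h1 h2] := IH i; exists (n + m); [constructor|rewrite [n + k]addrC addrKA].
Qed.

(** The letters are replaced one by one by their homogeneous components; in the
    generalized statement, u is the part of the word already treated. *)
Lemma tcoalg_hword_ind (P : tcoalg X -> Prop) :
  P 0 -> (forall a x y, P x -> P y -> P (a *: x + y)) ->
  (forall k w, hword k w -> P (tword w)) -> forall t, P t.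
Proof.
move=> P0 PD Ph; apply: tword_ind => // w.
suff H k u : hword k u -> P (tword (u ++ w)) by apply: (H 0 [::]); constructor.
elim: w k u => [|x w IH] k u hu; first by rewrite cats0; exact: Ph hu.
elim/graded_ind: x => [|a x y Hx Hy|i x hx].
- suff -> : tword (u ++ 0 :: w) = 0 by [].
  exact: (@lin0 _ _ _ (fun x : X => tword (u ++ x :: w)) (tword_multilin u w)).
- by rewrite tword_multilin; apply: PD.
rewrite -cat_rcons -cats1; apply: (IH (k + (i + 0))).
by apply: hword_cat => //; apply: hword_cons => //; exact: hword_nil.
Qed.

Lemma tcoalg2_hword_ind (Q : tensor (tcoalg X) (tcoalg X) -> Prop) :
  Q 0 -> (forall a x y, Q x -> Q y -> Q (a *: x + y)) ->
  (forall j k u v, hword j u -> hword k v -> Q (tword u \ox tword v)) -> forall t, Q t.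
Proof.
move=> Q0 QD Qh; apply: tens_ind => // s t.
elim/tcoalg_hword_ind: s => [|a x y Hx Hy|j u hu]; first by rewrite tens0l.
  by rewrite tens_linearl; exact: QD.
elim/tcoalg_hword_ind: t => [|a x y Hx Hy|k v hv]; first by rewrite tens0r.
  by rewrite tens_linearr; exact: QD.
exact: Qh hu hv.
Qed.

Lemma of_degree_tcoalg (W : gradedType K) (F : {linear tcoalg X -> W}) :
  (forall k w, hword k w -> homog k (F (tword w))) -> of_degree 0 F.
Proof.
move=> hF; apply: (of_degree_span (G := fun k t => exists2 w, hword k w & t = tword w)).
- by move=> k _ [w hw ->]; exact: hword_homog.
- move=> P P0 PD PG; apply: tcoalg_hword_ind => // k w hw.
  by apply: (PG k); exists w.
- by move=> k _ [w hw ->]; exact: hF.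
Qed.

Lemma of_degree_tcoalg2 (W : gradedType K)
    (F : {linear tensor (tcoalg X) (tcoalg X) -> W}) :
  (forall j k u v, hword j u -> hword k v -> homog (j + k) (F (tword u \ox tword v))) ->
  of_degree 0 F.
Proof.
move=> hF; apply: (of_degree_span (G := fun n t => exists j k u v,
  [/\ n = j + k, hword j u, hword k v & t = tword u \ox tword v])).
- by move=> _ _ [j [k [u [v [-> hu hv ->]]]]]; apply: homog_tens; exact: hword_homog.
- move=> P P0 PD PG; apply: tcoalg2_hword_ind => // j k u v hu hv.
  by apply: (PG (j + k)); exists j, k, u, v.
- by move=> _ _ [j [k [u [v [-> hu hv ->]]]]]; exact: hF.
Qed.

Lemma deconc_degree : of_degree 0 (deconc : tcoalg X -> _).
Proof.
apply: of_degree_tcoalg => k w hw; rewrite /= deconcE; apply: homog_sum => i.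
have [m h1 h2] := hword_split i hw; rewrite -[k](subrK m) addrC.
by apply: homog_tens; exact: hword_homog.
Qed.

Lemma tcounit_degree : of_degree 0 (tcounit : tcoalg X -> _).
Proof.
apply: of_degree_tcoalg => k w [|n j x u _ _]; rewrite /= tcounitE //=.
exact: homog0.
Qed.

Lemma conc_degree : of_degree 0 (conc : tensor (tcoalg X) (tcoalg X) -> _).
Proof.
apply: of_degree_tcoalg2 => j k u v hu hv; rewrite /= concE.
by apply: hword_homog; exact: hword_cat.
Qed.
End Words.

Lemma hword_map (X Y : gradedType K) (f : {linear X -> Y}) k w :
  of_degree 0 f -> hword k w -> hword k (map f w).
Proof.
move=> hf; elim=> [|n {}k x {}w hx _ IH] /=; constructor => //.
by rewrite -[n]addr0; exact: hf.
Qed.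

Lemma wmap_degree (X Y : gradedType K) (f : {linear X -> Y}) :
  of_degree 0 f -> of_degree 0 (wmap f).
Proof.
move=> hf; apply: of_degree_tcoalg => k w hw; rewrite /= wmapE.
by apply: hword_homog; exact: hword_map.
Qed.
End Degrees.

(** * The recursion that determines an element from its coproduct *)

Section HeadRecursion.
Variables (K : fieldType) (X : lmodType K).

Definition letter (x : X) : tcoalg X := tword [:: x].
Fact letter_linear : linear letter.
Proof. exact: (tword_multilin [::] [::]). Qed.
HB.instance Definition _ :=
  GRing.isLinear.Build K X (tcoalg X) *:%R letter letter_linear.

(** s (x) t |-> p_1(s) . t *)
Definition head_conc : tensor (tcoalg X) (tcoalg X) -> tcoalg X :=
  conc \o tmap (letter \o tproj1) idfun.
HB.instance Definition _ := GRing.Linear.on head_conc.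

Lemma head_concE s t : head_conc (s \ox t) = conc (letter (tproj1 s) \ox t).
Proof. by rewrite /head_conc /= tmapE. Qed.

Lemma head_conc0 s t : tproj1 s = 0 -> head_conc (s \ox t) = 0.
Proof. by rewrite head_concE => ->; rewrite linear0 tens0l linear0. Qed.

(** In the deconcatenation of a nonempty word, only the cut after the first letter
    has a first factor of length one, and concatenating its two factors gives the
    word back. *)
Lemma head_recursion (t : tcoalg X) :
  t = (tcounit t : K) *: tone + head_conc (deconc t).
Proof.
elim/tword_ind: t => [|a y z Hy Hz|w]; first by rewrite !linear0 scale0r addr0.
  rewrite !linearP /= -[a *: tcounit y]/(a * _) scalerDl -scalerA addrACA.
  by rewrite -scalerDr -Hy -Hz.
have p1tone : tproj1 (tone : tcoalg X) = 0 by rewrite tproj1E.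
case: w => [|x w]; rewrite tcounitE /=.
  by rewrite deconc_nil head_conc0 // addr0 scale1r.
rewrite scale0r add0r deconcE linear_sum 2!big_ord_recl /= big1 => [|i _].
  by rewrite head_conc0 // take0 drop0 addr0 add0r head_concE tproj1E concE.
by rewrite head_conc0 // tproj1E; case: w i => // -[].
Qed.
End HeadRecursion.

(** * Uniqueness of maps into the tensor coalgebra *)

Section Uniqueness.
Variables (K : fieldType) (X Y : gradedType K).
Notation TX := (tcoalg X).
Notation TY := (tcoalg Y).

Lemma tens_comul_word (u v : seq X) :
  tens_comul deconc (tword u \ox tword v) =
  \sum_(i < (size u).+1) \sum_(l < (size v).+1)
    midswap (tword (take i u) \ox tword (drop i u) \ox
            (tword (take l v) \ox tword (drop l v))).
Proof.
rewrite /tens_comul /= tmapE /= !deconcE tens_suml linear_sum; apply: eq_bigr => i _.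
by rewrite !linear_sum.
Qed.

(** By head_recursion and induction on the total length of u (x) v. Words with
    homogeneous letters are used so that the sign in the coproduct of u (x) v is a
    scalar, common to F and G. *)
Lemma coalg_map_unique (F G : {linear tensor TX TX -> TY}) :
  (forall t, deconc (F t) = tmap F F (tens_comul deconc t)) ->
  (forall t, deconc (G t) = tmap G G (tens_comul deconc t)) ->
  (forall t, tcounit (F t) = tcounit (G t)) ->
  (forall u v, tproj1 (F (tword u \ox tword v)) = tproj1 (G (tword u \ox tword v))) ->
  tproj1 (F (tone \ox tone)) = 0 ->
  F =1 G.
Proof.
move=> hF hG he hp h1; elim/tcoalg2_hword_ind => [|a x y Hx Hy|j k u v hu hv].
- by rewrite !linear0.
- by rewrite !linearP Hx Hy.
have [n] := ubnP (size u + size v).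
elim: n => // n IH in j k u v hu hv *; rewrite ltnS => le_n.
rewrite (head_recursion (F _)) (head_recursion (G _)) he hF hG; congr (_ + _).
rewrite tens_comul_word !linear_sum; apply: eq_bigr => i _.
rewrite !linear_sum; apply: eq_bigr => l _ /=.
have [m _ hu'] := hword_split i hu; have [m' hv1 hv2] := hword_split l hv.
rewrite (midswapE _ _ (hword_homog hu') (hword_homog hv1)).
rewrite !linearZ /=; congr (_ *: _); rewrite !tmapE.
(* The term with both prefixes empty is the only one whose second factor is not
   shorter, and there the first factor is killed by the projection. *)
have [il0|il0] := posnP (i + l)%N.
  have [-> ->] : i = 0%N :> nat /\ l = 0%N :> nat.
    by move/eqP: il0; rewrite addn_eq0 => /andP[/eqP ? /eqP ?].
  by rewrite !take0 !head_conc0 // -hp.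
rewrite !head_concE hp; congr (conc (_ \ox _)).
apply: IH hu' hv2 _; apply: leq_trans le_n.
have := ltn_ord i; have := ltn_ord l; rewrite !ltnS => lv iu.
by rewrite !size_drop addnBA // addnBAC // -subnDA ltn_subrL il0 (leq_trans il0) ?leq_add.
Qed.

(** Uniqueness for coderivations along a map S. In the applications T is S up to a
    Koszul sign, and that sign only matters through the value of T at 1. *)
Lemma coder_along_unique (F G S T : {linear TX -> TY}) :
  (forall t, deconc (F t) = tmap F S (deconc t) + tmap T F (deconc t)) ->
  (forall t, deconc (G t) = tmap G S (deconc t) + tmap T G (deconc t)) ->
  (forall t, tcounit (F t) = tcounit (G t)) ->
  (forall w, tproj1 (F (tword w)) = tproj1 (G (tword w))) ->
  tproj1 (T tone) = 0 ->
  F =1 G.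
Proof.
move=> hF hG he hp h1; elim/tword_ind => [|a x y Hx Hy|w].
- by rewrite !linear0.
- by rewrite !linearP Hx Hy.
have [n] := ubnP (size w); elim: n => // n IH in w *; rewrite ltnS => le_n.
rewrite (head_recursion (F _)) (head_recursion (G _)) he hF hG; congr (_ + _).
rewrite !linearD !deconcE !linear_sum; congr (_ + _); apply: eq_bigr => i _ /=.
  by rewrite !tmapE !head_concE hp.
rewrite !tmapE; have [i0|i0] := posnP i; first by rewrite i0 take0 !head_conc0.
rewrite !head_concE IH // size_drop.
by apply: leq_trans le_n; rewrite ltn_subrL i0 (leq_trans i0 _) // -ltnS.
Qed.
End Uniqueness.

(** * Counits and coderivations *)

Section Counit.
Variable K : fieldType.

Lemma scalar_koszul e (c : K^o) : koszul e c = c.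
Proof.
have hc : homog 0 c by rewrite /homog.
by rewrite (koszul_homog _ hc) mulr0 expr0z scale1r.
Qed.

Fact scalar_mul_bilin : bilin (fun a b : K^o => a * b : K^o).
Proof.
split=> [b|a] c x y; first by rewrite mulrDl -mulrA.
by rewrite mulrDr mulrCA.
Qed.

(** Contract with the multiplication of the field. *)
Lemma tens1_eq0 (a : K^o) : a \ox (1 : K^o) = 0 -> a = 0.
Proof.
move=> a0; rewrite -[a]mulr1 -(tens_liftE scalar_mul_bilin a (1 : K^o)) a0.
exact: linear0.
Qed.

Lemma koszul_tone (X : gradedType K) e : koszul e tone = tone :> tcoalg X.
Proof.
by rewrite (koszul_homog _ (hword_homog (hword_nil X))) mulr0 expr0z scale1r.
Qed.

(** The left counit axiom writes 1 (x) d x as (e (x) id) D (d x), which is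
    (e d (x) id) D x + 1 (x) d x, the sign in the second summand being invisible
    to e. So (e d (x) id) D x = 0, and the right counit axiom turns this into
    e (d x) (x) 1 = 0. *)
Lemma counit_coderivation (V : gradedType K) (D : {linear V -> tensor V V})
    (e : {linear V -> K^o}) (one : V) (d : {linear V -> V}) x :
  unital_coalgebra D e one -> coderivation D d -> e (d x) = 0.
Proof.
move=> [[_ e_deg] _ counitl counitr _] hd; apply: tens1_eq0.
have e_koszul n v : e (koszul n v) = e v by rewrite -(koszul_nat _ _ e_deg) scalar_koszul.
have d0 : tmap (e \o d) idfun (D x) = 0.
  have := counitl (d x); rewrite hd linearD /= /gtmap -!tmap_comp.
  rewrite [X in _ + X](_ : _ = (1 : K^o) \ox d x) => [/eqP|].
    by rewrite -subr_eq0 addrK => /eqP.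
  transitivity (tmap idfun d (tmap e idfun (D x))).
    rewrite -tmap_comp.
    elim/tens_ind: (D x) => [|a y z Hy Hz|r s]; first by rewrite !linear0.
      by rewrite !linearP /= Hy Hz.
    by rewrite !tmapE /= e_koszul.
  by rewrite counitl tmapE.
have := congr1 (tmap idfun e) d0.
by rewrite tmap_swap counitr tmapE linear0.
Qed.
End Counit.

(** * The map induced on words by a linear map *)

Section WordMap.
Variables (K : fieldType) (X Y : lmodType K) (f : {linear X -> Y}).

Lemma wmap_tproj1 t : tproj1 (wmap f t) = f (tproj1 t).
Proof.
elim/tword_ind: t => [|a x y Hx Hy|w]; first by rewrite !linear0.
  by rewrite !linearP /= Hx Hy.
by rewrite wmapE !tproj1E; case: w => [|x [|y w]] //=; rewrite linear0.
Qed.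

Lemma wmap_tcounit t : tcounit (wmap f t) = tcounit t.
Proof.
elim/tword_ind: t => [|a x y Hx Hy|w]; first by rewrite !linear0.
  by rewrite !linearP /= Hx Hy.
by rewrite wmapE !tcounitE; case: w.
Qed.

Lemma wmap_deconc t : deconc (wmap f t) = tmap (wmap f) (wmap f) (deconc t).
Proof.
elim/tword_ind: t => [|a x y Hx Hy|w]; first by rewrite !linear0.
  by rewrite !linearP /= Hx Hy.
rewrite wmapE !deconcE linear_sum size_map; apply: eq_bigr => i _.
by rewrite /= tmapE /= !wmapE map_take map_drop.
Qed.

Lemma wmap_conc t : wmap f (conc t) = conc (tmap (wmap f) (wmap f) t).
Proof.
elim/tens_ind: t => [|a x y Hx Hy|s t]; first by rewrite !linear0.
  by rewrite !linearP /= Hx Hy.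
elim/tword_ind: s => [|a y z Hy Hz|u]; first by rewrite !(tens0l, linear0).
  by rewrite !(tens_linearl, linearP) /= Hy Hz.
elim/tword_ind: t => [|a y z Hy Hz|v]; first by rewrite !linear0.
  by rewrite !linearP /= Hy Hz.
by rewrite tmapE /= !wmapE !concE wmapE map_cat.
Qed.
End WordMap.

(** * The enveloping bialgebra and its functoriality *)

Section Enveloping.
Variable K : fieldType.

Lemma tcoalg_unital_coalgebra (X : gradedType K) :
  @unital_coalgebra K (tcoalg X) deconc tcounit tone.
Proof.
split; [|exact: deconc_coassoc|exact: deconc_counitl|exact: deconc_counitr|].
  by split; [exact: deconc_degree|exact: tcounit_degree].
split; [exact: hword_homog (hword_nil X)|exact: deconc_nil|].
by rewrite /= tcounitE.
Qed.

Lemma conc_unital_assoc (X : gradedType K) : @unital_assoc K (tcoalg X) conc tone.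
Proof. by split; [exact: concA|exact: conc1l|exact: conc1r]. Qed.

Lemma U_bialgP (A : binf_alg K) : two_as_dbialg (U_bialg A).
Proof.
have [deg_mul _ _] := binf_mul_coalg A.
split.
- split; [|exact: binf_mul_unital|exact: conc_unital_assoc
          |exact: binf_differential|exact: binf_derivation].
  split; [exact: deg_mul|exact: conc_degree|exact: hword_homog (hword_nil A)].
- exact: tcoalg_unital_coalgebra.
- exact: binf_mul_coalg.
- exact: binf_coderivation.
- exact: deconc_conc.
Qed.

Lemma U_cofree (A : binf_alg K) : cofree (U_bialg A).
Proof.
exists A, idfun; split=> // [||x].
- by exists idfun.
- exact: of_degree0_id.
- by rewrite tmap_id.
Qed.

Section Functoriality.
Variables (A B : binf_alg K) (f : binf_hom A B).

(** Both sides are coderivations along T^c(f), and both project to f m_n on words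
    of length n >= 1. *)
Lemma wmap_diff t : wmap f (binf_diff A t) = binf_diff B (wmap f t).
Proof.
move: t; apply: (coder_along_unique (F := wmap f \o binf_diff A)
  (G := binf_diff B \o wmap f) (S := wmap f) (T := wmap f \o koszul (-1)))
  => [t|t|t|w|] /=.
- by rewrite wmap_deconc binf_coderivation linearD /= /gtmap -!tmap_comp.
- rewrite binf_coderivation /= wmap_deconc /gtmap -!tmap_comp; congr (_ + _).
  elim/tens_ind: (deconc t) => [|a x y Hx Hy|r s]; first by rewrite !linear0.
    by rewrite !linearP /= Hx Hy.
  by rewrite !tmapE /= (koszul_nat _ _ (wmap_degree (binf_fun_deg f))).
- rewrite wmap_tcounit !(counit_coderivation _ (tcoalg_unital_coalgebra _)) //;
    exact: binf_coderivation.
- rewrite wmap_tproj1 wmapE; case: w => [|x w]; last first.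
    exact: (binf_fun_m f (in_tuple (x :: w))).
  by rewrite -!/tone !binf_diff1 !linear0.
- by rewrite koszul_tone wmapE tproj1E.
Qed.

(** Both sides are coalgebra maps, and both project to f m_{i,j} on pairs of
    words of lengths i, j >= 1. *)
Lemma wmap_mul t : wmap f (binf_mul A t) = binf_mul B (tmap (wmap f) (wmap f) t).
Proof.
have [_ dA eA] := binf_mul_coalg A; have [_ dB eB] := binf_mul_coalg B.
have [_ lA rA] := binf_mul_unital A; have [_ lB rB] := binf_mul_unital B.
move: t; apply: (coalg_map_unique (F := wmap f \o binf_mul A)
  (G := binf_mul B \o tmap (wmap f) (wmap f))) => [t|t|t|u v|] /=.
- by rewrite wmap_deconc dA -tmap_comp.
- rewrite dB tmap_comp /tens_comul /=; congr (tmap _ _ _).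
  rewrite -midswap_nat; try exact: wmap_degree (binf_fun_deg f).
  congr midswap; rewrite -!tmap_comp.
  elim/tens_ind: t => [|a x y Hx Hy|r s]; first by rewrite !linear0.
    by rewrite !linearP /= Hx Hy.
  by rewrite !tmapE /= !wmap_deconc.
- rewrite wmap_tcounit; elim/tens_ind: t => [|a x y Hx Hy|r s]; first by rewrite !linear0.
    by rewrite !linearP /= Hx Hy.
  by rewrite eA tmapE /= eB /= !wmap_tcounit.
- rewrite tmapE /= wmap_tproj1 !wmapE.
  (* The structure maps m_{i,j} only cover i, j >= 1; unitality does the rest. *)
  case: u => [|x u].
    by rewrite -!/tone lA lB !tproj1E; case: v => [|y [|z v]] //=; rewrite linear0.
  case: v => [|y v].
    by rewrite -!/tone rA rB !tproj1E; case: u => [|z u] //=; rewrite linear0.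
  exact: (binf_fun_mm f (in_tuple (x :: u)) (in_tuple (y :: v))).
- by rewrite lA wmapE tproj1E.
Qed.

Lemma wmap_bialg_hom : @is_bialg_hom K (U_bialg A) (U_bialg B) (wmap f).
Proof.
split; [exact: wmap_degree (binf_fun_deg f)|exact: wmap_diff|
       |exact: wmap_deconc|exact: wmap_tcounit].
by split; [exact: wmap_mul|exact: wmap_conc|exact: wmapE].
Qed.
End Functoriality.
End Enveloping.

Theorem proposition3p3p2 (K : fieldType) :
  exists (HU : forall A : binf_alg K, two_as_dbialg (U_bialg A))
         (HUm : forall (A B : binf_alg K) (f : binf_hom A B),
            @is_bialg_hom K (U_bialg A) (U_bialg B) (wmap f)),
    (forall A : binf_alg K, cofree (U_bialg A)) /\
    @is_functor (binf_cat K) (bialg_cat K)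
      (fun A => @Bialg K (U_bialg A) (HU A))
      (fun A B f => @BialgHom K (U_bialg A) (U_bialg B) (wmap f) (HUm A B f)).
Proof.
exists (@U_bialgP K), (@wmap_bialg_hom K); split; first exact: U_cofree.
split=> [A|A B C g f]; apply: bialg_hom_eq => t /=.
  elim/tword_ind: t => [|a x y Hx Hy|w]; rewrite ?linear0 //.
    by rewrite !linearP /= Hx Hy.
  by rewrite wmapE map_id.
elim/tword_ind: t => [|a x y Hx Hy|w]; first by rewrite !linear0.
  by rewrite !linearP /= Hx Hy.
by rewrite !wmapE map_comp.
Qed.
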